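(* There is a constant $C>0$ that does not depend on $\alpha,t,n,X$ such that the following holds. Let $\alpha\ge 1$ and let $X_1,\dots,X_n$ be i.i.d. mean-zero real-valued random variables, distributed as $X$, with $\|X\|_{\Psi_\alpha}<\infty$. Then for all $t>0$: if $\alpha\ge 2$, $$\mathbb P\left(\left|\sum_{i=1}^n X_i\right|\ge t\right)\le 2\exp\left(-C\max\left\{\frac{t^2}{n\|X\|_{\Psi_\alpha}^2},\frac{t^\alpha}{n^{\alpha-1}\|X\|_{\Psi_\alpha}^\alpha}\right\}\right),$$ and if $1\le\alpha\le 2$, $$\mathbb P\left(\left|\sum_{i=1}^n X_i\right|\ge t\right)\le 2\exp\left(-C\min\left\{\frac{t^2}{n\|X\|_{\Psi_\alpha}^2},\frac{t^\alpha}{n^{\alpha-1}\|X\|_{\Psi_\alpha}^\alpha}\right\}\right).$$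
   Context: For a real random variable $X$ and $\alpha\ge1$, the Orlicz norm is $\|X\|_{\Psi_\alpha}:=\inf\{u>0:\ \mathbb E\exp((|X|/u)^\alpha)\le 2\}$. *)

(* Defs.v *)
From HB Require Import structures.
From mathcomp Require Import all_boot all_order all_algebra.
From mathcomp Require Import all_classical all_reals all_analysis.
Set Implicit Arguments.
Unset Strict Implicit.
Unset Printing Implicit Defensive.
Import Order.TTheory GRing.Theory Num.Theory.
Import numFieldNormedType.Exports.
Local Open Scope classical_set_scope.
Local Open Scope ring_scope.
Local Open Scope ereal_scope.

(* The infimum is taken in [\bar R]: it is [+oo] when no [u] is admissible. *)
Definition orlicz_norm d (T : measurableType d) (R : realType)
    (P : probability T R) (alpha : R) (X : T -> R) : \bar R :=
  ereal_inf [set u%:E | u in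
    [set u : R | (0 < u)%R /\
       'E_P[fun w => expR ((`|X w| / u) `^ alpha)%R] <= 2%:E]].

Definition mutually_independent d (T : measurableType d) (R : realType)
    (P : probability T R) (I : finType) (X : I -> {RV P >-> R}) : Prop :=
  forall (J : {set I}) (B : I -> set R),
    (forall i, i \in J -> measurable (B i)) ->
    P (\bigcap_(i in [set` J]) X i @^-1` B i) =
    \prod_(i in J) P (X i @^-1` B i).

Definition identically_distributed d (T : measurableType d) (R : realType)
    (P : probability T R) (X Y : {RV P >-> R}) : Prop :=
  forall B : set R, measurable B -> distribution P X B = distribution P Y B.

(* Quotients are formed in [\bar R], where [0^-1 = +oo] and
   [expeR -oo = 0]; so in the degenerate case [K = 0] the tail bound
   [2 * exp (- C * ...)] is [0]. *)
Definition gaussian_exponent (R : realType) (n : nat) (K : \bar R) (t : R)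
    : \bar R :=
  (t ^+ 2)%:E / (n%:R%:E * K ^+ 2).

Definition weibull_exponent (R : realType) (alpha : R) (n : nat) (K : \bar R)
    (t : R) : \bar R :=
  (t `^ alpha)%:E / ((n%:R `^ (alpha - 1))%:E * K `^ alpha).

(* Main.v *)
Require Import Defs.
From HB Require Import structures.
From mathcomp Require Import all_boot all_order all_algebra.
From mathcomp Require Import all_classical all_reals all_analysis.
From mathcomp Require Import measurable_realfun ring lra.
Import Order.TTheory GRing.Theory Num.Theory.
Import numFieldNormedType.Exports.
Local Open Scope classical_set_scope.
Local Open Scope ring_scope.
Local Open Scope ereal_scope.
Set Implicit Arguments.
Unset Strict Implicit.
Unset Printing Implicit Defensive.

(** Write [r = t / (n u)] for a scale [u] admissible in the Orlicz norm, that
    is [E exp((|X|/u)^a) <= 2], and [S] for the sum of the variables.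

    The two regimes of the statement are one. Set [gauge a r = r^2] for
    [r <= 1] and [gauge a r = r^a] for [r > 1]. For [a >= 2] this is the maximum
    of [r^2] and [r^a], for [a <= 2] it is their minimum ([gauge_max],
    [gauge_min]), and the two exponents of the statement are [n r^2] and
    [n r^a]. So it suffices to bound [P(|S| >= n u r)] by
    [2 exp(- n gauge a r / 1024)], which [sum_tail] does for all [a >= 1].

    Only two exponential moment estimates are needed.
    - For [r <= 1], [sum_bernstein_tail]: centring and
      [E exp(|X/u|^a) <= 2] give [E exp(l X / u) <= exp(128 l^2)] for small [l]
      ([mgf_le]); take [l] proportional to [r].
    - For [r > 1], [sum_weibull_tail]: the tangent line of [x |-> x^a] at [r]
      shows that [|S| >= n u r] forces [sum_i (|X_i|/u)^a >= n r^a], whence the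
      bound [2^n exp(- n r^a)]. As [2 < e] and [r^a >= 1], the factor [2^n] only
      costs a constant in the exponent.

    Both estimates bound the probability of an event by the expectation of a
    product of functions of the separate [X_i], and this expectation factors
    because the variables are independent ([expectation_prod]).

    Finally [u] must be replaced by the infimum [K] of the admissible scales,
    which may fail to be attained a priori and may be [0]. As
    [gauge a r <= L] just means [r <= rho] for some [rho > 0]
    ([gauge_sublevel]), the tail bound at the scale [u] is a lower bound on [u],
    and it passes to [K] ([orlicz_tail_limit]). *)

(** * Expectation of a product of independent variables *)

Section weighted_change_of_variables.
Context d d' (T : measurableType d) (T' : measurableType d') (R : realType).
Variables (mu : {measure set T -> \bar R}) (nu : {measure set T' -> \bar R}).
Variables (Y : T -> T') (G : T -> R) (c : R).
Hypotheses (mY : measurable_fun setT Y) (mG : measurable_fun setT G).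
Hypothesis G0 : forall x, (0 <= G x)%R.
Hypothesis indicP : forall B, measurable B ->
  \int[mu]_x ((\1_B (Y x))%:E * (G x)%:E) = nu B * c%:E.

Import HBNNSimple.

Let int_nnsfun (h : {nnsfun T' >-> R}) :
  \int[mu]_x ((h (Y x))%:E * (G x)%:E) = (\int[nu]_y (h y)%:E) * c%:E.
Proof.
have v0 v y : 0 <= v%:E * (\1_(h @^-1` [set v]) y)%:E.
  exact: nnfun_muleindic_ge0.
have mI v : measurable_fun setT (fun y => v%:E * (\1_(h @^-1` [set v]) y)%:E).
  by apply: measurable_funeM; exact/measurable_EFinP/measurable_indic.
have hE y : (h y)%:E = \sum_(v \in range h) v%:E * (\1_(h @^-1` [set v]) y)%:E.
  by rewrite fimfunE -fsumEFin.
under [in RHS]eq_integral do rewrite hE.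
rewrite ge0_integral_fsum//= ge0_mule_fsuml; last first.
  by move=> v; exact: integral_ge0.
under eq_integral do rewrite hE ge0_mule_fsuml//.
rewrite /= ge0_integral_fsum//=; last 2 first.
- move=> v; apply: emeasurable_funM; last exact/measurable_EFinP.
  exact: (measurableT_comp (mI v)).
- by move=> v x _; rewrite mule_ge0// lee_fin.
apply: eq_fsbigr => v _.
have [vneg|vpos] := ltP v 0%R.
  have E0 : h @^-1` [set v] = set0 by apply: preimage_nnfun0.
  by rewrite !integral0_eq ?mul0e// => x _; rewrite E0 indic0 ?mule0 ?mul0e//.
under eq_integral do rewrite -muleA.
rewrite !ge0_integralZl//; last 3 first.
- apply: emeasurable_funM; last exact/measurable_EFinP.
  apply/measurable_EFinP; apply: (measurableT_comp _ mY).
  exact: measurable_indic.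
- by move=> x _; rewrite mule_ge0// lee_fin.
- exact/measurable_EFinP/measurable_indic.
by rewrite indicP// integral_indic// setIT muleA.
Qed.

(** Two set functions that agree on measurable sets have the same integrals;
    here one of them is the image under [Y] of the measure with density [G].
    This is what allows an indicator function to be replaced by an arbitrary
    function in one factor of a product. *)
Lemma ge0_integral_comp_weight (f : T' -> \bar R) :
  measurable_fun setT f -> (forall y, 0 <= f y) ->
  \int[mu]_x (f (Y x) * (G x)%:E) = (\int[nu]_y f y) * c%:E.
Proof.
move=> mf f0; pose f_ := nnsfun_approx measurableT mf.
have f_cvg y : (f_ n y)%:E @[n --> \oo] --> f y.
  exact: (@cvg_nnsfun_approx _ _ _ _ measurableT _ mf (fun x _ => f0 x)).
have f_nd y : nondecreasing_seq (fun n => (f_ n y)%:E).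
  by move=> m n mn; rewrite lee_fin; exact/lefP/nd_nnsfun_approx.
have cvg_nu : \int[nu]_y (f_ n y)%:E @[n --> \oo] --> \int[nu]_y f y.
  rewrite (_ : f = fun y => limn (fun n => (f_ n y)%:E)); last first.
    by apply/funext => y; exact/esym/cvg_lim.
  apply: cvg_monotone_convergence => //.
  - by move=> n; exact/measurable_EFinP.
  - by move=> n y _; rewrite lee_fin.
rewrite (_ : (fun x => f (Y x) * (G x)%:E) =
   (fun x => limn (fun n => (f_ n (Y x))%:E * (G x)%:E))); last first.
  by apply/funext => x; apply/esym/cvg_lim => //; exact: cvgeZr.
rewrite monotone_convergence//.
- under eq_fun do rewrite int_nnsfun.
  by apply/cvg_lim => //; exact: cvgeZr.
- move=> n; apply: emeasurable_funM; last exact/measurable_EFinP.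
  by apply/measurable_EFinP; exact: (measurableT_comp _ mY).
- by move=> n x _; rewrite mule_ge0// lee_fin.
- by move=> x _ m n mn; apply: lee_wpmul2r; [rewrite lee_fin|exact: f_nd].
Qed.

End weighted_change_of_variables.

Lemma measurable_prod_cond d (T : measurableType d) (R : realType)
    (I : finType) (Q : pred I) (h : I -> T -> R) :
  (forall i, measurable_fun setT (h i)) ->
  measurable_fun setT (fun x => \prod_(i | Q i) h i x)%R.
Proof.
move=> mh; under eq_fun do rewrite -big_filter.
by apply: measurable_prod => i _; exact: mh.
Qed.

Section product_of_independent.
Context d (T : measurableType d) (R : realType) (P : probability T R).
Variables (I : finType) (X : I -> {RV P >-> R}).
Hypothesis indepX : mutually_independent X.

Let expectation_prod_indic (B : I -> set R) : (forall i, measurable (B i)) ->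
  \int[P]_w (\prod_i \1_(B i) (X i w))%:E = \prod_i P (X i @^-1` B i).
Proof.
move=> mB; have := @indepX [set: I]%SET B (fun i _ => mB i).
under [in RHS]eq_bigl do rewrite inE.
move=> <-; set A := \bigcap_(i in _) _.
have mA : measurable A.
  apply: fin_bigcap_measurable => // i _.
  exact: (measurable_funPTI (X i)).
rewrite -[in RHS](setIT A) -integral_indic//.
apply: eq_integral => w _; congr EFin.
rewrite indicE; case: (boolP (w \in A)) => [|] wA.
  apply: big1 => i _; rewrite indicE mem_set//.
  by move: wA; rewrite inE => /(_ i); apply; rewrite /= inE.
have /existsNP[i XiB] : ~ forall i, B i (X i w).
  by move=> wB; move/negP: wA; apply; rewrite inE => i _; exact: wB.
by rewrite (bigD1 i)//= indicE memNset ?mul0r.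
Qed.

(** The functions [f i] are freed one at a time: in the induction the set [A]
    contains the indices whose function is arbitrary, while the others carry
    indicators. When [A] is empty the claim is the product rule for events, and
    [ge0_integral_comp_weight] frees one more index, the product of the other
    factors being the weight. *)
Lemma expectation_prod (f : I -> R -> R) (e : I -> R) :
  (forall i, measurable_fun setT (f i)) ->
  (forall i x, (0 <= f i x)%R) ->
  (forall i, \int[P]_w (f i (X i w))%:E = (e i)%:E) ->
  \int[P]_w (\prod_i f i (X i w))%:E = (\prod_i e i)%:E.
Proof.
suff H (A : {set I}) : forall (f : I -> R -> R) (e : I -> R),
  (forall i, i \notin A -> exists2 B, measurable B & f i = \1_B) ->
  (forall i, measurable_fun setT (f i)) ->
  (forall i x, (0 <= f i x)%R) ->
  (forall i, \int[P]_w (f i (X i w))%:E = (e i)%:E) ->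
  \int[P]_w (\prod_i f i (X i w))%:E = (\prod_i e i)%:E.
  by apply: (H [set: I]%SET) => i; rewrite inE.
move: {2}(#|A|) (erefl #|A|) => m; elim: m A => [|m IH] A cA {}f {}e fA mf f0 fe.
  have /(_ _)/cid2 B i : exists2 B, measurable B & f i = \1_B.
    by apply: fA; rewrite (cards0_eq cA) inE.
  under eq_integral do under eq_bigr do rewrite (s2valP' (B _)).
  rewrite expectation_prod_indic; last by move=> i; exact: s2valP.
  have EFin_prod : {morph @EFin R : x y / (x * y)%R >-> x * y} by [].
  rewrite (big_morph _ EFin_prod (erefl 1)); apply: eq_bigr => i _.
  rewrite -fe [in RHS](s2valP' (B i)).
  have mB : measurable (X i @^-1` s2val (B i)).
    exact: (measurable_funPTI (X i)) (s2valP (B i)).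
  by rewrite -[in LHS](setIT (_ @^-1` _)) -integral_indic.
have [k kA] : exists k, k \in A by apply/card_gt0P; rewrite cA.
pose G w := (\prod_(i | i != k) f i (X i w))%R.
pose c := (\prod_(i | i != k) e i)%R.
rewrite (bigD1 k)//= EFinM -fe.
have mfX i : measurable_fun setT (fun w => f i (X i w)).
  exact: (measurableT_comp (mf i)).
have mG : measurable_fun setT G.
  by apply: measurable_prod_cond.
under eq_integral do rewrite (bigD1 k)//= EFinM.
have := @ge0_integral_comp_weight _ _ _ _ _ P (distribution P (X k)) (X k) G c.
move=> /(_ _ mG _ _ (fun x => (f k x)%:E)) ->//.
- rewrite ge0_integral_distribution//; first exact/measurable_EFinP.
  by move=> y; rewrite lee_fin.
- by move=> w; exact: prodr_ge0.
- move=> B mB.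
  pose g i : R -> R := if i == k then \1_B else f i.
  pose e' i := if i == k then fine (P (X k @^-1` B)) else e i.
  have mXB : measurable (X k @^-1` B) by exact: (measurable_funPTI (X k)).
  have : \int[P]_w (\prod_i g i (X i w))%:E = (\prod_i e' i)%:E.
    apply: (IH (A :\ k)%SET).
    + by have := cardsD1 k A; rewrite kA cA => -[].
    + move=> i; rewrite !inE negb_and negbK /g.
      by case: eqP => [_ _|_ /fA//]; exists B.
    + by move=> i; rewrite /g; case: eqP => // _; exact: measurable_indic.
    + by move=> i x; rewrite /g; case: eqP.
    + move=> i; rewrite /g /e'; case: eqP => [->|//].
      rewrite fineK ?fin_num_measure// -[in RHS](setIT (_ @^-1` _)).
      by rewrite -integral_indic.
  rewrite (bigD1 k)//= {1}/e' eqxx EFinM fineK ?fin_num_measure//.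
  rewrite (eq_bigr e); last by move=> i /negPf ik; rewrite /e' ik.
  move=> <-; apply: eq_integral => w _.
  rewrite (bigD1 k)//= {1}/g eqxx EFinM; congr (_ * _%:E).
  by apply: eq_bigr => i /negPf ik; rewrite /g ik.
- exact/measurable_EFinP.
- by move=> y; rewrite lee_fin.
Qed.

End product_of_independent.

Section tail_of_product.
Context d (T : measurableType d) (R : realType) (P : probability T R).
Variables (I : finType) (X : I -> {RV P >-> R}).
Hypothesis indepX : mutually_independent X.

(** Chernoff's method: with [f] exponential, the condition on [A] says that the
    sum of the exponents is nonnegative on [A]. *)
Lemma tail_le_prod (f : R -> R) (m : R) (A : set T) :
  measurable A -> measurable_fun setT f -> (forall x, (0 <= f x)%R) ->
  (forall i, \int[P]_w (f (X i w))%:E <= m%:E) ->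
  (forall w, A w -> (1 <= \prod_i f (X i w))%R) ->
  P A <= (m ^+ #|I|)%:E.
Proof.
move=> mA mf f0 fm fA.
have mfX i : measurable_fun setT (fun w => f (X i w)).
  exact: (measurableT_comp mf).
have int0 i : 0 <= \int[P]_w (f (X i w))%:E.
  by apply: integral_ge0 => w _; rewrite lee_fin.
pose e i := fine (\int[P]_w (f (X i w))%:E).
have fe i : \int[P]_w (f (X i w))%:E = (e i)%:E.
  by rewrite fineK// ge0_fin_numE// (le_lt_trans (fm i))// ltry.
have em i : (0 <= e i <= m)%R by rewrite -!lee_fin -fe int0 fm.
apply: (@le_trans _ _ (\int[P]_w (\prod_i f (X i w))%:E)).
  rewrite -[in leLHS](setIT A) -integral_indic//.
  apply: ge0_le_integral => //.
  - exact/measurable_EFinP/measurable_indic.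
  - by apply/measurable_EFinP; apply: measurable_prod_cond.
  move=> w _; rewrite lee_fin indicE; case: (boolP (w \in A)) => [|_].
    by rewrite inE => /fA.
  exact: prodr_ge0.
rewrite (@expectation_prod _ _ _ _ _ _ indepX (fun=> f) e)// lee_fin.
by rewrite -prodr_const; apply: ler_prod => i _; exact: em.
Qed.

End tail_of_product.

(** * Elementary inequalities *)

Section elementary.
Local Open Scope ring_scope.
Variable R : realType.
Implicit Types x y z l a : R.

(** From [1 - x <= exp(-x)] one gets [exp x - 1 <= x exp x], and the difference
    [exp x - 1 - x] is at most [x (exp x - 1)]. *)
Lemma expR_le_quadratic x : expR x <= 1 + x + x ^+ 2 * expR `|x|.
Proof.
have eN : (1 - x) * expR x <= 1.
  have := expR_ge1Dx (- x); have := expR_ge0 x; have := expRxMexpNx_1 x.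
  nra.
have e1 := expR_ge1Dx x.
have [x0|x0] := leP 0 x.
  rewrite ger0_norm//; nra.
have : 1 <= expR `|x| by rewrite -expR0 ler_expR.
nra.
Qed.

Lemma sqr_le_expR x : x ^+ 2 <= 16 * expR (`|x| / 2).
Proof.
have := expR_ge1Dx (`|x| / 4) => e4.
have x0 := normr_ge0 x.
have -> : expR (`|x| / 2) = expR (`|x| / 4) ^+ 2.
  by rewrite -expRM_natl; congr expR; field.
rewrite -real_normK ?num_real//; nra.
Qed.

(** Young's inequality [z * 1 <= z^a / a + 1 / q] with [q] conjugate to [a]. *)
Lemma bernoulli_powR a z : 1 <= a -> 0 <= z -> 1 + a * (z - 1) <= z `^ a.
Proof.
rewrite le_eqVlt => /predU1P[<- z0|a1 z0].
  by rewrite powRr1//; lra.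
have a0 : 0 < a by rewrite (lt_trans _ a1).
have q0 : 0 < a / (a - 1) by rewrite divr_gt0// subr_gt0.
have := @conjugate_powR R z 1 a (a / (a - 1)) z0 ler01 a0 q0.
rewrite powR1 mulr1 invf_div mul1r.
have -> : a^-1 + (a - 1) / a = 1 by field; rewrite gt_eqF.
move=> /(_ erefl).
rewrite -(ler_pM2r a0) mulrDl !divfK ?gt_eqF//; lra.
Qed.

Lemma le_1DpowR a y : 1 <= a -> 0 <= y -> y <= 1 + y `^ a.
Proof.
move=> a1 y0; have [y1|/ltW y1] := leP y 1.
  by rewrite ler_wpDr// powR_ge0.
by rewrite ler_wpDl// -[leLHS]powRr1// ler_powR.
Qed.

Lemma expR1_le4 : expR 1 <= 4 :> R.
Proof.
have h : 1 / 2 <= expR (- (1 / 2)) :> R.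
  by have := expR_ge1Dx (- (1 / 2) : R); lra.
have h1 := expRxMexpNx_1 (1 / 2 : R).
have h0 := expR_gt0 (1 / 2 : R).
have -> : expR 1 = expR (1 / 2) ^+ 2 :> R.
  by rewrite -expRM_natl; congr expR; field.
nra.
Qed.

Lemma le2_expR : 2 <= expR (3 / 4) :> R.
Proof.
have -> : expR (3 / 4) = expR (1 / 8) ^+ 6 :> R.
  by rewrite -expRM_natl; congr expR; field.
apply: (@le_trans _ _ ((9 / 8) ^+ 6)); first lra.
rewrite lerXn2r ?nnegrE ?expR_ge0//.
by have := expR_ge1Dx (1 / 8 : R); lra.
Qed.

(** The linear term vanishes in expectation for a centred variable, and the
    quadratic one is controlled by the Orlicz moment. The constant comes from
    [x^2 <= 16 exp(|x|/2)] and from [exp |y| <= e exp(|y|^a)] with [e <= 4]. *)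
Lemma expR_powR_le a l y : 1 <= a -> `|l| <= 1 / 2 ->
  expR (l * y) <= 1 + l * y + 64 * l ^+ 2 * expR (`|y| `^ a).
Proof.
move=> a1 l2; apply: (le_trans (expR_le_quadratic _)).
rewrite lerD2l exprMn.
have ya : `|y| <= 1 + `|y| `^ a by exact: le_1DpowR.
have e1 : expR `|l * y| <= expR (`|y| / 2).
  by rewrite ler_expR normrM mulrC ler_wpM2l//; lra.
have e2 : expR (`|y| / 2) * expR (`|y| / 2) <= 4 * expR (`|y| `^ a).
  rewrite -expRD -splitr; apply: (@le_trans _ _ (expR (1 + `|y| `^ a))).
    by rewrite ler_expR.
  by rewrite expRD ler_wpM2r ?expR_ge0// expR1_le4.
have e3 := sqr_le_expR y.
rewrite -[leLHS]mulrA [64 * _]mulrC -[leRHS]mulrA ler_wpM2l ?sqr_ge0//.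
apply: (@le_trans _ _ (16 * expR (`|y| / 2) * expR (`|y| / 2))).
  by rewrite ler_pM// ?sqr_ge0.
by rewrite -mulrA; lra.
Qed.

End elementary.

(** * The two tail bounds *)

Lemma measurable_expR_powR (R : realType) (a u : R) :
  measurable_fun setT (fun x : R => expR ((`|x| / u) `^ a)).
Proof.
apply: (measurableT_comp (@measurable_expR R)).
apply: (measurableT_comp (measurable_powR a)).
by apply: measurable_funM => //; exact: normr_measurable.
Qed.

Lemma measurable_abs_sum_ge d (T : measurableType d) (R : realType)
    (P : probability T R) (n : nat) (X : 'I_n -> {RV P >-> R}) (c : R) :
  measurable [set w | (c <= `|\sum_i X i w|)%R].
Proof.
rewrite -[X in measurable X]setTI.
apply: measurable_fun_le => //.
apply: (measurableT_comp (@normr_measurable R setT)).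
by apply: measurable_sum => i.
Qed.

Section sum_tails.
Context d (T : measurableType d) (R : realType) (P : probability T R).
Variables (n : nat) (X : 'I_n -> {RV P >-> R}) (a u : R).
Hypotheses (indepX : mutually_independent X).
Hypotheses (a1 : (1 <= a)%R) (u0 : (0 < u)%R).
Hypothesis orliczX : forall i,
  \int[P]_w (expR ((`|X i w| / u) `^ a))%:E <= 2%:E.

Let measurable_sumX : measurable_fun setT (fun w => (\sum_i X i w)%R).
Proof. by apply: measurable_sum => i. Qed.

(** Chernoff's method with the function [exp((|x|/u)^a - r^a)], whose expectation
    is at most [2 exp(- r^a)]. *)
Lemma sum_weibull_tail (r : R) : (0 < r)%R ->
  P [set w | (n%:R * u * r <= `|\sum_i X i w|)%R] <=
  (2 ^+ n * expR (- (n%:R * r `^ a)))%:E.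
Proof.
move=> r0; pose m : R := (2 * expR (- r `^ a))%R.
have -> : (2 ^+ n * expR (- (n%:R * r `^ a)) = m ^+ #|'I_n|)%R.
  by rewrite card_ord exprMn -expRM_natl mulrN.
apply: (tail_le_prod indepX (f := fun x =>
  (expR (- r `^ a) * expR ((`|x| / u) `^ a))%R)).
- exact: measurable_abs_sum_ge.
- by apply: measurable_funM => //; exact: measurable_expR_powR.
- by move=> x; rewrite mulr_ge0// expR_ge0.
- move=> i; under eq_integral do rewrite EFinM.
  rewrite ge0_integralZl//=.
  + by rewrite /m mulrC EFinM lee_wpmul2l// lee_fin expR_ge0.
  + apply/measurable_EFinP.
    exact: (measurableT_comp (measurable_expR_powR a u)).
- move=> w /= ht.
  under eq_bigr do rewrite -expRD addrC.
  rewrite -expR_sum -[leLHS]expR0 ler_expR.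
  (* the tangent line of [x |-> x^a] at [r], evaluated at [|X_i| / u] *)
  apply: (@le_trans _ _ (\sum_(i < n) (r `^ a * a * (`|X i w| / u / r - 1))))%R.
    rewrite -mulr_sumr mulr_ge0//.
      by rewrite mulr_ge0 ?powR_ge0// (le_trans ler01).
    rewrite big_split/= sumrN sumr_const card_ord subr_ge0 -!mulr_suml.
    rewrite !ler_pdivlMr// (le_trans _ (ler_norm_sum _ _ _))//.
    by rewrite mulrAC.
  apply: ler_sum => i _.
  have z0 : (0 <= `|X i w| / u / r)%R by rewrite !divr_ge0// ltW.
  have := bernoulli_powR a1 z0.
  have -> : ((`|X i w| / u) `^ a = r `^ a * (`|X i w| / u / r) `^ a)%R.
    rewrite -powRM//; last exact: ltW.
    by congr (_ `^ a)%R; field; rewrite !gt_eqF.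
  have := powR_gt0 a r0.
  by nra.
Qed.

Hypothesis meanX : forall i, \int[P]_w (X i w)%:E = 0.

Let orliczfun i :
  measurable_fun setT (fun w => (expR ((`|X i w| / u) `^ a))%:E).
Proof.
apply/measurable_EFinP.
exact: (measurableT_comp (measurable_expR_powR a u)).
Qed.

Let integrable_orlicz i :
  P.-integrable setT (fun w => (expR ((`|X i w| / u) `^ a))%:E).
Proof.
apply/integrableP; split=> //.
under eq_integral do rewrite gee0_abs ?lee_fin ?expR_ge0//.
exact: le_lt_trans (orliczX i) (ltry _).
Qed.

Let integrableX i : P.-integrable setT (fun w => (X i w)%:E).
Proof.
have := integrableZl measurableT u (integrable_orlicz i).
apply: le_integrable => //; first exact/measurable_EFinP.
move=> w _; rewrite -EFinM !abse_EFin lee_fin.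
rewrite [leRHS]ger0_norm; last by rewrite mulr_ge0 ?expR_ge0// ltW.
set y := (`|X i w| / u)%R.
have y0 : (0 <= y)%R by rewrite divr_ge0// ltW.
have -> : `|X i w|%R = (u * y)%R by rewrite /y; field; rewrite gt_eqF.
apply: ler_wpM2l; first exact: ltW.
exact: le_trans (le_1DpowR a1 y0) (expR_ge1Dx _).
Qed.

Let measurable_mgf i (l : R) :
  measurable_fun setT (fun w => expR (l * (X i w / u))).
Proof.
apply: measurableT_comp => //.
by apply: measurable_funM => //; exact: measurable_funM.
Qed.

Lemma mgf_le (i : 'I_n) (l : R) : (`|l| <= 1 / 2)%R ->
  \int[P]_w (expR (l * (X i w / u)))%:E <= (expR (128 * l ^+ 2))%:E.
Proof.
move=> l2.
apply: (@le_trans _ _ (\int[P]_w (((1 + (l / u) * X i w) +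
    64 * l ^+ 2 * expR ((`|X i w| / u) `^ a)))%:E)).
  apply: ge0_le_integral => //.
  - exact/measurable_EFinP.
  - apply/measurable_EFinP; apply: measurable_funD.
      by apply: measurable_funD => //; apply: measurable_funM.
    apply: measurable_funM => //.
    exact: (measurableT_comp (measurable_expR_powR a u)).
  move=> w _; rewrite lee_fin.
  have := expR_powR_le (X i w / u) a1 l2.
  rewrite normrM (gtr0_norm (x := u^-1)) ?invr_gt0//.
  by rewrite -[(l / u * _)%R]mulrA [(u^-1 * _)%R]mulrC.
under eq_integral do rewrite !EFinD (EFinM (l / u)) (EFinM (64 * _)).
have int1 : P.-integrable setT (fun=> 1%:E).
  exact: finite_measure_integrable_cst.
have intX := integrableZl measurableT (l / u) (integrableX i).
have intE := integrableZl measurableT (64 * l ^+ 2) (integrable_orlicz i).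
rewrite integralD//; last exact: integrableD.
rewrite integralD// !integralZl// meanX mule0 adde0 integral_cst//.
rewrite [X in _ * X + _](probability_setT P).
apply: (@le_trans _ _ (1 + (64 * l ^+ 2)%:E * 2%:E)).
  by rewrite mule1 leeD2l// lee_wpmul2l// lee_fin mulr_ge0// sqr_ge0.
rewrite -EFinM -EFinD lee_fin (le_trans _ (expR_ge1Dx _))//; lra.
Qed.

(** One-sided for each of [s = 1] and [s = -1]; the restriction [r <= 1] keeps
    the parameter [l] in the range where [mgf_le] applies. *)
Lemma sum_bernstein_tail_signed (s r : R) : (`|s| = 1)%R -> (0 < r <= 1)%R ->
  P [set w | (n%:R * u * r <= s * \sum_i X i w)%R] <=
  (expR (- (n%:R * r ^+ 2 / 512)))%:E.
Proof.
move=> s1 /andP[r0 r1]; pose m : R := expR (- (r ^+ 2 / 512))%R.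
have -> : (expR (- (n%:R * r ^+ 2 / 512)) = m ^+ #|'I_n|)%R.
  by rewrite card_ord -expRM_natl; congr expR; field.
have s2 : (s ^+ 2 = 1)%R by rewrite -real_normK ?num_real// s1 expr1n.
(* minimizes [128 l^2 - |l| r], the exponent of the Chernoff bound *)
pose l := (s * r / 256)%R.
apply: (tail_le_prod indepX (f := fun x =>
  (expR (- (r ^+ 2 / 256)) * expR (l * (x / u)))%R)).
- rewrite -[X in measurable X]setTI.
  apply: measurable_fun_le => //.
  by apply: measurable_funM.
- apply: measurable_funM => //; apply: measurableT_comp => //.
  by apply: measurable_funM => //; exact: measurable_funM.
- by move=> x; exact: mulr_ge0 (expR_ge0 _) (expR_ge0 _).
- move=> i; under eq_integral do rewrite EFinM.
  rewrite (ge0_integralZl _ measurableT); first last.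
  + by rewrite lee_fin expR_ge0.
  + by move=> w _; rewrite lee_fin expR_ge0.
  + exact/measurable_EFinP.
  apply: (le_trans (lee_wpmul2l _ (mgf_le i _))).
  + by rewrite lee_fin expR_ge0.
  + rewrite /l !normrM s1 mul1r !gtr0_norm ?invr_gt0 ?ltr0n//; lra.
  + rewrite lee_fin -expRD ler_expR /l !exprMn s2; lra.
- move=> w /= ht.
  under eq_bigr do rewrite -expRD.
  rewrite -expR_sum -[leLHS]expR0 ler_expR.
  rewrite big_split/= sumr_const card_ord -mulr_sumr -mulr_suml.
  have nr : (n%:R * r <= s * ((\sum_i X i w) / u))%R.
    by rewrite mulrA ler_pdivlMr// mulrAC.
  have := ler_wpM2l (ltW r0) nr; rewrite -mulr_natl /l; lra.
Qed.

Lemma sum_bernstein_tail (r : R) : (0 < r <= 1)%R ->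
  P [set w | (n%:R * u * r <= `|\sum_i X i w|)%R] <=
  (2 * expR (- (n%:R * r ^+ 2 / 512)))%:E.
Proof.
move=> r01; pose A s := [set w | (n%:R * u * r <= s * \sum_i X i w)%R].
have mA s : measurable (A s).
  rewrite -[X in measurable X]setTI.
  apply: measurable_fun_le => //.
  by apply: measurable_funM.
have -> : [set w | (n%:R * u * r <= `|\sum_i X i w|)%R] = A 1%R `|` A (-1)%R.
  by apply/seteqP; split=> w /=; rewrite /A /= mul1r mulN1r ler_normr => /orP.
apply: (le_trans (measureU2 _ _ _)) => //.
rewrite mulrDl mul1r EFinD; apply: leeD; apply: sum_bernstein_tail_signed => //.
  by rewrite normr1.
by rewrite normrN1.
Qed.

End sum_tails.

(** * Combining the two regimes *)

Section gauge.
Local Open Scope ring_scope.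
Variable R : realType.
Implicit Types a r L : R.

Definition gauge a r := if r <= 1 then r ^+ 2 else r `^ a.

Lemma gauge_gt0 a r : 0 < r -> 0 < gauge a r.
Proof. by rewrite /gauge => r0; case: ifP => _; rewrite ?exprn_gt0 ?powR_gt0. Qed.

Lemma gauge_max a r : 2 <= a -> 0 < r -> Num.max (r ^+ 2) (r `^ a) = gauge a r.
Proof.
move=> a2 r0; rewrite /gauge -(powR_mulrn 2 (ltW r0)); case: ifPn => [r1|].
  by apply/max_idPl; rewrite ger_powR// r0.
by rewrite -ltNge => /ltW r1; apply/max_idPr; rewrite ler_powR.
Qed.

Lemma gauge_min a r : a <= 2 -> 0 < r -> Num.min (r ^+ 2) (r `^ a) = gauge a r.
Proof.
move=> a2 r0; rewrite /gauge -(powR_mulrn 2 (ltW r0)); case: ifPn => [r1|].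
  by apply/min_idPl; rewrite ger_powR// r0.
by rewrite -ltNge => /ltW r1; apply/min_idPr; rewrite ler_powR.
Qed.

(** The gauge is increasing and continuous, with inverse [L |-> sqrt L] below [1]
    and [L |-> L^(1/a)] above. *)
Lemma gauge_sublevel a L : 0 < a -> 0 < L ->
  exists2 rho, 0 < rho & forall r, 0 < r -> (gauge a r <= L) = (r <= rho).
Proof.
move=> a0 L0.
have pow1 (b r : R) : 0 < b -> 1 < r -> 1 < r `^ b.
  move=> b0 r1; have : 1 `^ b < r `^ b.
    by rewrite gt0_ltr_powR// ?nnegrE// ltW// (lt_trans ltr01).
  by rewrite powR1.
have [L1|L1] := leP L 1.
  exists (Num.sqrt L); first by rewrite sqrtr_gt0.
  move=> r r0; rewrite /gauge; case: ifPn => [r1|].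
    rewrite -[in LHS](sqr_sqrtr (ltW L0)).
    by rewrite ler_sqr ?nnegrE ?sqrtr_ge0 // ltW.
  rewrite -ltNge => r1; apply/idP/idP.
    by move=> /le_trans/(_ L1); rewrite leNgt pow1.
  have sL1 : Num.sqrt L <= 1 by rewrite -sqrtr1 ler_sqrt.
  by move=> /le_trans/(_ sL1); rewrite leNgt r1.
exists (L `^ a^-1); first exact: powR_gt0.
move=> r r0; rewrite /gauge; case: ifPn => [r1|].
  have -> : r ^+ 2 <= L by rewrite (le_trans _ (ltW L1))// expr_le1// ltW.
  by rewrite (le_trans r1)// ltW// pow1// invr_gt0.
rewrite -ltNge => r1.
have La : L = (L `^ a^-1) `^ a by rewrite -powRrM mulVf ?gt_eqF// powRr1// ltW.
rewrite [in LHS]La; apply/idP/idP => [|h].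
  rewrite !leNgt; apply: contraNN => h.
  by rewrite gt0_ltr_powR// ?nnegrE ?powR_ge0 ?ltW.
by rewrite ge0_ler_powR// ?nnegrE ?powR_ge0 ?ltW.
Qed.

End gauge.

Section combined_tail.
Context d (T : measurableType d) (R : realType) (P : probability T R).
Variables (n : nat) (X : 'I_n -> {RV P >-> R}) (a u : R).
Hypotheses (indepX : mutually_independent X).
Hypotheses (a1 : (1 <= a)%R) (u0 : (0 < u)%R).
Hypothesis orliczX : forall i,
  \int[P]_w (expR ((`|X i w| / u) `^ a))%:E <= 2%:E.
Hypothesis meanX : forall i, \int[P]_w (X i w)%:E = 0.

Lemma sum_tail (r : R) : (0 < r)%R ->
  P [set w | (n%:R * u * r <= `|\sum_i X i w|)%R] <=
  (2 * expR (- (1024^-1 * (n%:R * gauge a r))))%:E.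
Proof.
move=> r0; have n0 : (0 <= n%:R :> R)%R by [].
rewrite /gauge; case: ifPn => [r1|].
  have r01 : (0 < r <= 1)%R by rewrite r0.
  apply: (le_trans (sum_bernstein_tail indepX a1 u0 orliczX meanX r01)).
  rewrite lee_fin ler_wpM2l// ler_expR lerN2.
  have := mulr_ge0 n0 (sqr_ge0 r); lra.
rewrite -ltNge => r1.
have ra : (1 <= r `^ a)%R.
  by rewrite (le_trans (ltW r1))// le1r_powR// ltW.
apply: (le_trans (sum_weibull_tail indepX a1 u0 orliczX r0)).
rewrite lee_fin.
apply: (@le_trans _ _ (expR (n%:R * (3 / 4)) * expR (- (n%:R * r `^ a)))%R).
  by rewrite ler_wpM2r ?expR_ge0// expRM_natl lerXn2r ?nnegrE ?expR_ge0// le2_expR.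
rewrite -expRD.
apply: (@le_trans _ _ (1 * expR (- (1024^-1 * (n%:R * r `^ a))))%R).
  rewrite mul1r ler_expR.
  have := ler_wpM2l n0 ra; lra.
by rewrite ler_wpM2r ?expR_ge0// ler1n.
Qed.

End combined_tail.

(** * From admissible scales to the Orlicz norm *)

Section orlicz.
Context d (T : measurableType d) (R : realType) (P : probability T R).

Lemma orlicz_moment_ident (X Y : {RV P >-> R}) (a u : R) :
  identically_distributed X Y ->
  \int[P]_w (expR ((`|X w| / u) `^ a))%:E =
  \int[P]_w (expR ((`|Y w| / u) `^ a))%:E.
Proof.
move=> XY; pose f (x : R) := (expR ((`|x| / u) `^ a))%:E.
have mf : measurable_fun setT f.
  by apply/measurable_EFinP; exact: measurable_expR_powR.
have f0 y : 0 <= f y by rewrite lee_fin expR_ge0.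
rewrite -(ge0_integral_distribution X mf f0).
rewrite -(ge0_integral_distribution Y mf f0).
by apply: eq_measure_integral => B mB _; exact: XY.
Qed.

(** Unless [P A = 0], the hypothesis at [u] amounts to
    [gauge a (t / (n u)) <= L] with [L] independent of [u], hence to
    [t / (n rho) <= u]; such a lower bound holds for the infimum as well. It also
    shows that the norm is positive, so the norm can vanish only if
    [P A = 0]. *)
Lemma orlicz_tail_limit (a : R) (n : nat) (X : {RV P >-> R}) (A : set T)
    (c t : R) : (0 < a)%R -> (0 < n)%N -> (0 < c)%R -> (0 < t)%R ->
  P A \is a fin_num ->
  orlicz_norm P a X < +oo ->
  (forall u : R, (0 < u)%R ->
    'E_P[fun w => expR ((`|X w| / u) `^ a)%R] <= 2%:E ->
    P A <= (2 * expR (- (c * (n%:R * gauge a (t / (n%:R * u))))))%:E) ->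
  P A = 0 \/ exists2 k, (0 < k)%R & orlicz_norm P a X = k%:E /\
    P A <= (2 * expR (- (c * (n%:R * gauge a (t / (n%:R * k))))))%:E.
Proof.
move=> a0 n0 c0 t0 Afin Koo bound.
have : 0 <= P A by [].
rewrite le_eqVlt => /predU1P[<-|PA0]; [by left|right].
set p := fine (P A); have pE : P A = p%:E by rewrite fineK.
have p0 : (0 < p)%R by rewrite -lte_fin -pE.
have nR0 : (0 < n%:R :> R)%R by rewrite ltr0n.
have cn0 : (0 < c * n%:R)%R by exact: mulr_gt0.
pose L := (- ln (p / 2) / (c * n%:R))%R.
have boundE g : (p%:E <= (2 * expR (- (c * (n%:R * g))))%:E) = (g <= L)%R.
  rewrite lee_fin mulrC -ler_pdivrMr// -{1}(lnK (x := (p / 2)%R)) ?posrE ?divr_gt0//.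
  by rewrite ler_expR lerNr /L mulrA ler_pdivlMr// mulrC.
have [u0 u00 Eu0] : exists2 u : R, (0 < u)%R &
    'E_P[fun w => expR ((`|X w| / u) `^ a)%R] <= 2%:E.
  apply: contrapT => nou.
  have K_oo : orlicz_norm P a X = +oo.
    rewrite /orlicz_norm (_ : [set _ | _ in _] = set0) ?ereal_inf0//.
    by apply/seteqP; split => // x [u [u1 u2] _]; apply: nou; exists u.
  by rewrite K_oo in Koo.
have rpos u : (0 < u)%R -> (0 < t / (n%:R * u))%R.
  by move=> u1; rewrite divr_gt0// mulr_gt0.
have L0 : (0 < L)%R.
  apply: (@lt_le_trans _ _ (gauge a (t / (n%:R * u0)))).
    exact/gauge_gt0/rpos.
  by rewrite -boundE -pE; exact: bound.
have [rho rho0 rhoP] := gauge_sublevel a0 L0.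
have uP u : (0 < u)%R ->
    (gauge a (t / (n%:R * u)) <= L)%R = (t / (n%:R * rho) <= u)%R.
  move=> u1; rewrite rhoP ?rpos//.
  by rewrite !ler_pdivrMr ?mulr_gt0// mulrCA mulrA [(u * _)%R]mulrC.
have lbK : (t / (n%:R * rho))%:E <= orlicz_norm P a X.
  apply: le_ereal_inf_tmp => _ [u [u1 Eu] <-].
  by rewrite lee_fin -uP// -boundE -pE; exact: bound.
have lb0 : (0 < t / (n%:R * rho))%R by exact: rpos.
have [k kE] : exists k, orlicz_norm P a X = k%:E.
  by move: Koo lbK; case: (orlicz_norm P a X) => // k _ _; exists k.
have k0 : (0 < k)%R.
  by rewrite -lte_fin -kE (lt_le_trans _ lbK)// lte_fin.
exists k => //; split => //.
by rewrite pE boundE uP// -lee_fin -kE.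
Qed.

End orlicz.

Section exponents.
Variable R : realType.

Lemma gaussian_exponentE (n : nat) (k t : R) : (0 < n)%N -> (0 < k)%R ->
  gaussian_exponent n k%:E t = (n%:R * (t / (n%:R * k)) ^+ 2)%:E.
Proof.
move=> n0 k0; have nR0 : (0 < n%:R :> R)%R by rewrite ltr0n.
rewrite /gaussian_exponent -EFin_expe -EFinM inver gt_eqF ?mulr_gt0 ?exprn_gt0//.
by rewrite -EFinM; congr EFin; field; rewrite !gt_eqF.
Qed.

Lemma weibull_exponentE (a : R) (n : nat) (k t : R) :
  (0 < a)%R -> (0 < n)%N -> (0 < k)%R -> (0 < t)%R ->
  weibull_exponent a n k%:E t = (n%:R * (t / (n%:R * k)) `^ a)%:E.
Proof.
move=> a0 n0 k0 t0; have nR0 : (0 < n%:R :> R)%R by rewrite ltr0n.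
rewrite /weibull_exponent poweR_EFin -EFinM inver gt_eqF ?mulr_gt0 ?powR_gt0//.
rewrite -EFinM; congr EFin.
have nk0 : (0 < n%:R * k)%R by exact: mulr_gt0.
have -> : (t `^ a = (t / (n%:R * k)) `^ a * (n%:R * n%:R `^ (a - 1) * k `^ a))%R.
  rewrite mulr_powRB1//.
  rewrite -!powRM ?divr_ge0 ?ltW//; first by rewrite divfK// gt_eqF.
by field; rewrite !gt_eqF ?powR_gt0.
Qed.

End exponents.

(** * The theorem *)

Theorem corollary1 (R : realType) :
  exists C : R, (0 < C)%R /\
  forall (d : measure_display) (T : measurableType d) (P : probability T R)
    (alpha : R) (n : nat) (X : {RV P >-> R}) (Xs : 'I_n -> {RV P >-> R}),
    (1 <= alpha)%R -> (0 < n)%N ->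
    mutually_independent Xs ->
    (forall i, identically_distributed (Xs i) X) ->
    (forall i, 'E_P[Xs i] = 0) ->
    orlicz_norm P alpha X < +oo ->
    forall t : R, (0 < t)%R ->
      ((2 <= alpha)%R ->
        P [set w | (t <= `|\sum_(i < n) Xs i w|)%R] <=
        2%:E * expeR (- (C%:E *
          maxe (gaussian_exponent n (orlicz_norm P alpha X) t)
               (weibull_exponent alpha n (orlicz_norm P alpha X) t)))) /\
      ((alpha <= 2)%R ->
        P [set w | (t <= `|\sum_(i < n) Xs i w|)%R] <=
        2%:E * expeR (- (C%:E *
          mine (gaussian_exponent n (orlicz_norm P alpha X) t)
               (weibull_exponent alpha n (orlicz_norm P alpha X) t)))).
Proof.
(* [c] stays abstract so that simplification does not expand the numeral *)
have [c c0 cE] : exists2 c : R, (0 < c)%R & c = 1024^-1%R.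
  by exists 1024^-1%R; first by rewrite invr_gt0 ltr0n.
exists c; split => //.
move=> d T P a n X Xs a1 n0 indep ident mean Koo t t0.
have a0 : (0 < a)%R by exact: lt_le_trans a1.
have nR0 : (0 < n%:R :> R)%R by rewrite ltr0n.
set A := [set w | _].
have bound (u : R) : (0 < u)%R ->
    'E_P[fun w => expR ((`|X w| / u) `^ a)%R] <= 2%:E ->
    P A <= (2 * expR (- (c * (n%:R * gauge a (t / (n%:R * u))))))%:E.
  move=> u0; rewrite unlock => Eu.
  have nu0 : (0 < n%:R * u)%R by exact: mulr_gt0.
  have orliczXs i : \int[P]_w (expR ((`|Xs i w| / u) `^ a))%:E <= 2%:E.
    by rewrite (orlicz_moment_ident _ _ (ident i)).
  have meanXs i : \int[P]_w (Xs i w)%:E = 0.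
    by have := mean i; rewrite unlock.
  have := sum_tail indep a1 u0 orliczXs meanXs (divr_gt0 t0 nu0).
  by rewrite -cE mulrC divfK ?gt_eqF.
have Afin : P A \is a fin_num.
  by apply: fin_num_measure; exact: measurable_abs_sum_ge.
have [->|[k k0 [-> PA]]] := orlicz_tail_limit a0 n0 c0 t0 Afin Koo bound.
  by split=> _; rewrite mule_ge0// expeR_ge0.
rewrite gaussian_exponentE// weibull_exponentE//.
have r0 : (0 < t / (n%:R * k))%R by rewrite divr_gt0// mulr_gt0.
split=> a2.
  by rewrite -EFin_max -maxr_pMr ?(ltW nR0)// gauge_max.
by rewrite -EFin_min -minr_pMr ?(ltW nR0)// gauge_min.
Qed.
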